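(* Let $(\mathcal M,\mathfrak v)$ be a tropical toric vector bundle over $X_\Sigma$, $\Sigma$ a complete fan. The following are equivalent. (a) The class $[(\mathcal M,\mathfrak v)]$ contains a member of the form $(B,\mathfrak v)$, where $B$ is a single basis (i.e. the matroid is a free matroid, whose ground set is a basis). (b) The class $[(\mathcal M,\mathfrak v)]$ contains the pair associated to a direct sum of toric line bundles. (c) The class $[(\mathcal M,\mathfrak v)]$ contains a pair $(\mathcal M',\mathfrak v')$ which is split.
   Context: For a loop-free matroid $\mathcal M$, $\operatorname{Berg}(\mathcal M)\subset\mathbb R^{\mathcal M}$ is the set of $w$ such that for every circuit $C$ the minimum $\min_{i\in C}w_i$ is attained at least twice (equivalently, all sets $F^w_t=\{i:w_i\ge t\}$ are flats). For a basis $B$, the apartment $A_B$ is the set of $w\in\operatorname{Berg}(\mathcal M)$ with $w_e=\min\{w_b:b\in C_e\setminus\{e\}\}$ for all $e\notin B$, where $C_e$ is the unique circuit in $B\cup\{e\}$; projection to the $B$-coordinates identifies $A_B$ with $\mathbb R^B$. $N$ is a lattice and $\Sigma$ a complete fan in $N_{\mathbb R}$. A tropical toric vector bundle over $X_\Sigma$ with matroid $\mathcal M$ is a map $\Phi:N_{\mathbb R}\to\operatorname{Berg}(\mathcal M)$ with $\Phi(N)\subset\mathbb Z^{\mathcal M}$ such that for each $\sigma\in\Sigma$ there is a basis $B_\sigma$ with $\Phi(\sigma)\subset A_{B_\sigma}$ and $\Phi|_\sigma$, in the coordinates $\mathbb R^{B_\sigma}$, the restriction of a linear map. It is equivalently recorded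 by the functions $\mathfrak v(e):N_{\mathbb R}\to\mathbb R$, $\mathfrak v(e)(x)=\Phi(x)_e$, $e\in\mathcal M$, and written $(\mathcal M,\Phi)$ or $(\mathcal M,\mathfrak v)$. A toric line bundle on $X_\Sigma$ corresponds to an integral function $\psi:N_{\mathbb R}\to\mathbb R$ linear on the cones of $\Sigma$. The pair associated to a direct sum of $r$ toric line bundles $\psi_1,\dots,\psi_r$ is the free matroid $U_{r,r}$ on $b_1,\dots,b_r$ (for which $\operatorname{Berg}=\mathbb R^r$) with $\mathfrak v(b_i)=\psi_i$. A matroid extension $\phi:\mathcal M_1\to\mathcal M_2$ is an injection of ground sets of matroids of equal rank such that the matroid induced by $\mathcal M_2$ on $\phi(\mathcal M_1)$ is $\mathcal M_1$. It induces $\phi_*:\operatorname{Berg}(\mathcal M_1)\to\operatorname{Berg}(\mathcal M_2)$, $(\phi_*w)_e=\sup\{t:e\in\operatorname{span}\phi(F^w_t)\}$ (span = matroid closure). The class $[(\mathcal M,\Phi)]=[(\mathcal M,\mathfrak v)]$ is the equivalence class under the equivalence relation generated by $(\mathcal M_1,\Phi_1)\sim(\mathcal M_2,\phi_*\circ\Phi_1)$. A pair $(\mathcal M,\Phi)$ is split if the image of $\Phi$ lies in a single apartment of $\operatorname{Berg}(\mathcal M)$. *)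

(* Defs.v *)
From mathcomp Require Import all_boot all_order all_algebra.
From mathcomp Require Import all_classical all_reals.
From Stdlib Require Import Relation_Operators.

Set Implicit Arguments.
Unset Strict Implicit.
Unset Printing Implicit Defensive.

Import Order.TTheory GRing.Theory Num.Theory.
Local Open Scope ring_scope.

Record matroid (T : finType) := Matroid {
  indep : {set T} -> bool;
  indep_set0 : indep finset.set0;
  indep_subset : forall A B : {set T}, A \subset B -> indep B -> indep A;
  indep_augment : forall A B : {set T}, indep A -> indep B ->
    (#|A| < #|B|)%N -> exists2 e, e \in B :\: A & indep (e |: A)
}.

Section MatroidNotions.
Context {T : finType} (M : matroid T).

Definition is_basis (B : {set T}) : bool := maxset (indep M) B.

Definition is_circuit (C : {set T}) : bool := minset (fun A => ~~ indep M A) C.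

Definition mrank (A : {set T}) : nat :=
  (\max_(I : {set T} | indep M I && (I \subset A)) #|I|)%N.

Definition mspan (A : {set T}) : {set T} :=
  [set e | mrank (e |: A) == mrank A]%SET.

Definition loop_free : Prop := forall e : T, indep M [set e]%SET.

Definition is_free : Prop := is_basis [set: T]%SET.

End MatroidNotions.

Lemma free_indep_augment (T : finType) (A B : {set T}) : true -> true ->
  (#|A| < #|B|)%N -> exists2 e, e \in B :\: A & true.
Proof.
move=> _ _ ltAB; suff /set0Pn[e He] : B :\: A != finset.set0 by exists e.
by apply: contraL ltAB; rewrite finset.setD_eq0 -leqNgt; apply: subset_leq_card.
Qed.

Definition free_matroid (T : finType) : matroid T :=
  @Matroid T (fun _ => true) isT (fun _ _ _ _ => isT) (@free_indep_augment T).

Section Bergman.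
Context {R : realType} {T : finType} (M : matroid T).

Definition is_min_on (w : T -> R) (A : {set T}) (m : R) : Prop :=
  (exists2 i, i \in A & w i = m) /\ (forall i, i \in A -> m <= w i).

Definition Berg : set (T -> R) :=
  [set w | forall C : {set T}, is_circuit M C ->
     exists i j, [/\ i \in C, j \in C, i != j,
                     is_min_on w C (w i) & is_min_on w C (w j)]]%classic.

(* When [B] is a basis and [e \notin B], exactly one circuit [C] is contained
   in [e |: B], namely the fundamental circuit of [e]. *)
Definition apartment (B : {set T}) : set (T -> R) :=
  [set w | Berg w /\
     forall (e : T) (C : {set T}), e \notin B ->
       is_circuit M C -> C \subset e |: B -> is_min_on w (C :\ e) (w e)]%classic.

(* The flat [F^w_t]. *)
Definition superlevel (w : T -> R) (t : R) : {set T} := [set i | t <= w i]%SET.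

End Bergman.

Definition is_extension (T1 T2 : finType) (M1 : matroid T1) (M2 : matroid T2)
    (phi : T1 -> T2) : Prop :=
  [/\ injective phi,
      mrank M1 [set: T1]%SET = mrank M2 [set: T2]%SET
    & forall A : {set T1}, indep M1 A = indep M2 (phi @: A)%SET].

Definition push (R : realType) (T1 T2 : finType) (M2 : matroid T2)
    (phi : T1 -> T2) (w : T1 -> R) : T2 -> R :=
  fun e => sup [set t : R | e \in mspan M2 (phi @: superlevel w t)%SET]%classic.

(* The lattice [N] of rank [n] is identified with Z^n inside
   [N_R = 'rV[R]_n]; linear functionals on [N_R] are [{scalar 'rV[R]_n}]. *)
Section Fans.
Context {R : realType} {n : nat}.
Implicit Types (sigma tau : set 'rV[R]_n) (Sigma : set (set 'rV[R]_n)).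

Definition lattice_point (z : 'rV[int]_n) : 'rV[R]_n := map_mx intr z.

Definition rational_polyhedral_cone sigma : Prop :=
  exists (k : nat) (g : 'I_k -> 'rV[int]_n),
    sigma = [set x | exists c : 'I_k -> R,
      (forall i, 0 <= c i) /\ x = \sum_i c i *: lattice_point (g i)]%classic.

Definition strongly_convex sigma : Prop :=
  forall x, sigma x -> sigma (- x) -> x = 0.

Definition is_face tau sigma : Prop :=
  exists u : {scalar 'rV[R]_n}, (forall x, sigma x -> 0 <= u x) /\
    tau = [set x | sigma x /\ u x = 0]%classic.

Definition is_fan Sigma : Prop :=
  [/\ finite_set Sigma,
      forall sigma, Sigma sigma ->
        rational_polyhedral_cone sigma /\ strongly_convex sigma,
      forall sigma tau, Sigma sigma -> is_face tau sigma -> Sigma tau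
    & forall sigma tau, Sigma sigma -> Sigma tau ->
        is_face (sigma `&` tau)%classic sigma /\
        is_face (sigma `&` tau)%classic tau].

Definition is_complete Sigma : Prop :=
  forall x : 'rV[R]_n, exists2 sigma, Sigma sigma & sigma x.

Definition is_integral (f : 'rV[R]_n -> R) : Prop :=
  forall z : 'rV[int]_n, f (lattice_point z) \is a Num.int.

Definition linear_on sigma (f : 'rV[R]_n -> R) : Prop :=
  exists l : {scalar 'rV[R]_n}, forall x, sigma x -> f x = l x.

End Fans.

Section Bundles.
Context {R : realType} {n : nat} (Sigma : set (set 'rV[R]_n)).

(* A tropical toric vector bundle [(M, Phi)]; linearity of [Phi] on a cone in
   the coordinates R^B is linearity of each coordinate [b \in B]. *)
Record ttvb := TTVB {
  ground : finType;
  bmatroid : matroid ground;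
  Phi : 'rV[R]_n -> ground -> R;
  ttvb_loop_free : loop_free bmatroid;
  ttvb_Berg : forall x, Berg bmatroid (Phi x);
  ttvb_integral : forall e, is_integral (fun x => Phi x e);
  ttvb_linear : forall sigma, Sigma sigma ->
    exists B : {set ground},
      [/\ is_basis bmatroid B,
          forall x, sigma x -> apartment bmatroid B (Phi x)
        & forall b, b \in B -> linear_on sigma (fun x => Phi x b)]
}.

Arguments Phi : clear implicits.

Definition extension_step (E1 E2 : ttvb) : Prop :=
  exists2 phi : ground E1 -> ground E2,
    is_extension (bmatroid E1) (bmatroid E2) phi
    & forall x, Phi E2 x = push (bmatroid E2) phi (Phi E1 x).

Definition same_class : ttvb -> ttvb -> Prop :=
  clos_refl_sym_trans ttvb extension_step.

Definition is_split (E : ttvb) : Prop :=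
  exists2 B : {set ground E}, is_basis (bmatroid E) B
    & forall x, apartment (bmatroid E) B (Phi E x).

Record line_bundle := LineBundle {
  lb_fun :> 'rV[R]_n -> R;
  lb_integral : is_integral lb_fun;
  lb_linear : forall sigma, Sigma sigma -> linear_on sigma lb_fun
}.

Section DirectSum.
Context {r : nat} (psi : 'I_r -> line_bundle).

Let dsPhi (x : 'rV[R]_n) (i : 'I_r) : R := psi i x.

Fact direct_sum_Berg x : Berg (free_matroid 'I_r) (dsPhi x).
Proof. by move=> C /minsetp. Qed.

Fact direct_sum_linear sigma : Sigma sigma ->
  exists B : {set 'I_r},
    [/\ is_basis (free_matroid 'I_r) B,
        forall x, sigma x -> apartment (free_matroid 'I_r) B (dsPhi x)
      & forall b, b \in B -> linear_on sigma (fun x => dsPhi x b)].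
Proof.
move=> hs; exists [set: 'I_r]%SET; split.
- by apply/maxsetP; split=> // B _; rewrite finset.subTset => /eqP.
- by move=> x _; split=> [|e C]; [exact: direct_sum_Berg | rewrite inE].
- by move=> b _; exact: lb_linear.
Qed.

Definition direct_sum : ttvb :=
  @TTVB 'I_r (free_matroid 'I_r) (fun x i => psi i x)
    (fun _ => isT) direct_sum_Berg (fun i => lb_integral (psi i))
    direct_sum_linear.

End DirectSum.
End Bundles.

Arguments Phi {R n Sigma}.

(* Main.v *)
Require Import Defs.
From mathcomp Require Import all_boot all_order all_algebra.
From mathcomp Require Import all_classical all_reals.
From Stdlib Require Import Relation_Operators.

(** A bundle over a free matroid is split, and a direct sum of line bundles
    lives over a free matroid, so everything rests on showing that a split
    bundle [Phi], with image in the apartment of a basis [B], is equivalent to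
    a direct sum. The summands are the coordinates of [Phi] along [B].

    That this direct sum extends to the given bundle is a statement about one
    apartment: a point [w] of [A_B] is recovered from its [B]-coordinates by
    [push], because the flat [{w >= t}] is the span of its trace on [B]
    ([apartment_mem_mspan], [push_apartment]).

    The real issue is that each coordinate [b \in B] must be linear on each
    cone [sigma], although [Phi] is only known to be linear on [sigma] in the
    coordinates of another basis [Bs], which depends on [sigma]
    ([split_coordinate_linear]). Since [w \in A_Bs], the coordinate [w b] is
    one of the coordinates of [Bs] or a minimum of several of them, so every
    [b \in B] is dominated on [sigma] by a coordinate [j b \in Bs] that agrees
    with it at a chosen point [x0]. A basis has maximal weight with respect to
    any point of its apartment, so on the intersection of [A_B] and [A_Bs] the
    total weights of [B] and [Bs] coincide ([apartment_sum_eq]). Hence the sum over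
    [b \in B] of the nonnegative gaps [w (j b) - w b] is linear on [sigma].
    With [x0] the sum of the generators of [sigma], a nonnegative linear
    function vanishing at [x0] vanishes on all of [sigma]
    ([cone_interior_point]); so every gap is zero and [w b] equals the linear
    function [w (j b)]. *)

Set Implicit Arguments.
Unset Strict Implicit.
Unset Printing Implicit Defensive.

Import Order.TTheory GRing.Theory Num.Theory.
Local Open Scope ring_scope.

(** * Bases and ranks *)

Section MatroidFacts.
Context {T : finType} (M : matroid T).
Implicit Types (A B C I : {set T}) (e : T).

Lemma basis_indep B : is_basis M B -> indep M B.
Proof. by case/maxsetP. Qed.

Lemma card_indep_basis B I : is_basis M B -> indep M I -> (#|I| <= #|B|)%N.
Proof.
case/maxsetP=> indB maxB indI; rewrite leqNgt; apply/negP.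
case/(indep_augment indB indI)=> e; rewrite inE => /andP[eNB _] ind_eB.
by move: eNB; rewrite -(maxB _ ind_eB (finset.subsetUr _ _)) finset.setU11.
Qed.

Lemma card_basis B1 B2 : is_basis M B1 -> is_basis M B2 -> #|B1| = #|B2|.
Proof.
by move=> b1 b2; apply/eqP; rewrite eqn_leq !card_indep_basis ?basis_indep.
Qed.

Lemma mrank_leq A k :
  (forall I, indep M I -> I \subset A -> (#|I| <= k)%N) -> (mrank M A <= k)%N.
Proof. by move=> leIk; apply/bigmax_leqP => I /andP[]; apply: leIk. Qed.

Lemma mrank_indep A : indep M A -> mrank M A = #|A|.
Proof.
move=> indA; apply/eqP; rewrite eqn_leq; apply/andP; split.
  by apply: mrank_leq => I _; apply: subset_leq_card.
by apply: (bigop.bigmax_sup A); rewrite ?indA /=.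
Qed.

Lemma mrank_basis B : is_basis M B -> mrank M [set: T]%SET = #|B|.
Proof.
move=> bB; apply/eqP; rewrite eqn_leq; apply/andP; split.
  by apply: mrank_leq => I indI _; apply: card_indep_basis.
by apply: (bigop.bigmax_sup B); rewrite ?finset.subsetT ?basis_indep.
Qed.

Lemma mem_mspan_indep A e : indep M A ->
  (forall I, indep M I -> I \subset e |: A -> (#|I| <= #|A|)%N) ->
  e \in mspan M A.
Proof.
move=> indA leIA; rewrite inE eqn_leq (mrank_indep indA) mrank_leq //=.
by apply: (bigop.bigmax_sup A); rewrite ?indA ?finset.subsetUr.
Qed.

Lemma mspan_indepF A e :
  e \notin A -> indep M (e |: A) -> e \notin mspan M A.
Proof.
move=> eNA ind_eA; have indA := indep_subset (finset.subsetUr _ _) ind_eA.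
by rewrite inE !mrank_indep // cardsU1 eNA eqn_leq ltnn.
Qed.

Lemma dependent_circuit A : ~~ indep M A ->
  exists2 C, is_circuit M C & C \subset A.
Proof.
move=> depA.
by have [C cC CA] := minset_exists (depA : (fun A => ~~ indep M A) A); exists C.
Qed.

Lemma circuitNindep C : is_circuit M C -> ~~ indep M C.
Proof. by case/minsetP. Qed.

Lemma fundamental_circuit B e : is_basis M B -> e \notin B ->
  exists2 C, is_circuit M C & C \subset e |: B.
Proof.
case/maxsetP=> _ maxB eNB; apply: dependent_circuit; apply: contra eNB => ind.
by rewrite -(maxB _ ind (finset.subsetUr _ _)) finset.setU11.
Qed.

End MatroidFacts.

(** * Apartments and bases of maximal weight *)

Section Apartments.
Context {R : realType} {T : finType} (M : matroid T).
Implicit Types (A B C I : {set T}) (e : T) (w : T -> R).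

(** An element of [I] that augments the part of [B] above level [t] would lie
    off [B], and its fundamental circuit would be made of elements above
    level [t], hence be independent. *)
Lemma apartment_card_superlevel B w I t :
  is_basis M B -> apartment M B w -> indep M I ->
  (#|I :&: superlevel w t| <= #|B :&: superlevel w t|)%N.
Proof.
move=> bB [_ minB] indI; rewrite leqNgt; apply/negP => lt_BI.
have indIt := indep_subset (finset.subsetIl I (superlevel w t)) indI.
have indBt :=
  indep_subset (finset.subsetIl B (superlevel w t)) (basis_indep bB).
have [e] := indep_augment indBt indIt lt_BI.
rewrite !inE => /andP[+ /andP[_ le_te]]; rewrite le_te andbT => eNB ind_e.
have [C cC CeB] := fundamental_circuit bB eNB.
have [_ minC] := minB e C eNB cC CeB.
case/negP: (circuitNindep cC); apply: indep_subset ind_e.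
apply/fintype.subsetP => i iC; rewrite !inE.
have [//|/= i_ne] := eqVneq i e.
have := fintype.subsetP CeB i iC; rewrite !inE (negPf i_ne) /= => -> /=.
by apply: le_trans le_te _; apply: minC; rewrite !inE i_ne.
Qed.

(** Layer-cake comparison: matching a heaviest element of [A] with a heaviest
    one of [B] and removing both preserves the hypotheses. *)
Lemma ler_sum_superlevel w A B : #|A| = #|B| ->
  (forall t, (#|A :&: superlevel w t| <= #|B :&: superlevel w t|)%N) ->
  \sum_(a in A) w a <= \sum_(b in B) w b.
Proof.
elim: {A}#|A| {-2}A (erefl #|A|) B => [|k IHk] A cA B eqAB leAB.
  have /cards0_eq -> : #|B| = 0%N by rewrite -eqAB.
  by rewrite (cards0_eq cA) !big_set0.
have heaviest (D : {set T}) : (0 < #|D|)%N ->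
    exists2 d, d \in D & forall c, c \in D -> w c <= w d.
  by case/card_gt0P=> d0 /(arg_maxP w)[d dD maxd]; exists d.
have [a aA maxa] : exists2 a, a \in A & forall c, c \in A -> w c <= w a.
  by apply: heaviest; rewrite cA.
have [b bB maxb] : exists2 b, b \in B & forall c, c \in B -> w c <= w b.
  by apply: heaviest; rewrite -eqAB cA.
have le_ab : w a <= w b.
  have : (0 < #|B :&: superlevel w (w a)|)%N.
    apply: leq_trans (leAB _); apply/card_gt0P; exists a.
    by rewrite !inE aA lexx.
  case/card_gt0P=> c; rewrite !inE => /andP[cB lac].
  exact: le_trans lac (maxb c cB).
rewrite (big_setD1 a aA) (big_setD1 b bB) /= lerD //; apply: IHk.
- by have := cardsD1 a A; rewrite aA cA => -[].
- by have := cardsD1 b B; have := cardsD1 a A; rewrite aA bB eqAB => -> [].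
move=> t; have [le_ta|lt_at] := leP t (w a).
  have := leAB t.
  rewrite (cardsD1 a (A :&: _)) (cardsD1 b (B :&: _)) !inE aA bB le_ta.
  by rewrite (le_trans le_ta le_ab) /= ltnS !finset.setIDAC.
(* Above the maximum of [w] on [A] there is nothing left to count. *)
suff -> : (A :\ a) :&: superlevel w t = finset.set0 by rewrite cards0.
apply/setP => c; rewrite !inE; apply/negbTE/negP => /andP[/andP[_ cA'] le_tc].
by have := lt_le_trans lt_at (le_trans le_tc (maxa c cA')); rewrite ltxx.
Qed.

(** Both bases are of maximal weight for [w]. *)
Lemma apartment_sum_eq B1 B2 w : is_basis M B1 -> is_basis M B2 ->
  apartment M B1 w -> apartment M B2 w ->
  \sum_(b in B1) w b = \sum_(b in B2) w b.
Proof.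
move=> b1 b2 w1 w2; apply/eqP; rewrite eq_le; apply/andP; split.
  apply: ler_sum_superlevel => [|t]; first exact: card_basis b1 b2.
  exact: (apartment_card_superlevel t b2 w2 (basis_indep b1)).
apply: ler_sum_superlevel => [|t]; first exact: card_basis b2 b1.
exact: (apartment_card_superlevel t b1 w1 (basis_indep b2)).
Qed.

(** The flat [F^w_t] is spanned by its trace on [B]: this is what makes [w]
    recoverable from its [B]-coordinates. *)
Lemma apartment_mem_mspan B w e t : is_basis M B -> apartment M B w ->
  (e \in mspan M (B :&: superlevel w t)) = (t <= w e).
Proof.
move=> bB wB; have indB := basis_indep bB.
have indBt := indep_subset (finset.subsetIl B (superlevel w t)) indB.
apply/idP/idP => [eS|le_te].
  (* If [w e < t], then [e] closes a circuit with elements of [B] above [t],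
     over which [w e] is the minimum. *)
  rewrite leNgt; apply/negP => lt_et.
  have eNBt : e \notin B :&: superlevel w t by rewrite !inE leNgt lt_et andbF.
  have dep : ~~ indep M (e |: (B :&: superlevel w t)).
    by apply: contraTN eS; apply: mspan_indepF.
  have eNB : e \notin B.
    apply: contra dep => eB; apply: indep_subset indB.
    by rewrite finset.subUset finset.sub1set eB finset.subsetIl.
  have [C cC CeB] := dependent_circuit dep.
  have CeB' : C \subset e |: B.
    exact: fintype.subset_trans CeB (finset.setUS _ (finset.subsetIl _ _)).
  case: wB => _ /(_ e C eNB cC CeB')[[i iC wie] _].
  move: iC; rewrite !inE => /andP[i_ne /(fintype.subsetP CeB)].
  by rewrite !inE (negPf i_ne) wie leNgt lt_et andbF.
apply: mem_mspan_indep => // I indI sIe.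
have /finset.setIidPl <- : I \subset superlevel w t.
  apply/fintype.subsetP => i /(fintype.subsetP sIe).
  by rewrite !inE => /orP[/eqP -> //|/andP[]].
exact: (apartment_card_superlevel t bB wB indI).
Qed.

(** This is why the coordinates along a basis, as a point of the Bergman fan of
    a free matroid, extend to the point of the apartment they come from. *)
Lemma push_apartment (T0 : finType) (phi : T0 -> T) B w :
  is_basis M B -> apartment M B w -> phi @: [set: T0]%SET = B ->
  push M phi (w \o phi) = w.
Proof.
move=> bB wB phiB; apply/funext => e; rewrite /push.
have im t : phi @: superlevel (w \o phi) t = B :&: superlevel w t.
  apply/setP => i; rewrite !inE -phiB; apply/imsetP/andP => [[j]|[]].
    by rewrite inE => le_tj ->; rewrite imset_f ?inE.
  by case/imsetP=> j _ -> le_tj; exists j; rewrite ?inE.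
have -> : [set t | e \in mspan M (phi @: superlevel (w \o phi) t)]%classic
          = `]-oo, w e]%classic.
  by apply/seteqP; split=> t /=; rewrite im apartment_mem_mspan // in_itv.
by rewrite sup_itv.
Qed.

End Apartments.

(** * Linearity on cones *)

Section LinearOnCones.
Context {R : realType} {n : nat} (sigma : set 'rV[R]_n).
Implicit Types (f g : 'rV[R]_n -> R).

Lemma linear_onD f g : linear_on sigma f -> linear_on sigma g ->
  linear_on sigma (fun x => f x + g x).
Proof.
move=> [l fl] [m gm]; exists (l \+ m) => x sx /=.
by rewrite fl ?gm.
Qed.

Lemma linear_onB f g : linear_on sigma f -> linear_on sigma g ->
  linear_on sigma (fun x => f x - g x).
Proof.
move=> [l fl] [m gm]; exists (l \- m) => x sx /=.
by rewrite fl ?gm.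
Qed.

Lemma linear_on_sum (I : Type) (r : seq I) (P : pred I)
    (f : I -> 'rV[R]_n -> R) :
  (forall i, P i -> linear_on sigma (f i)) ->
  linear_on sigma (fun x => \sum_(i <- r | P i) f i x).
Proof.
move=> lf; elim: r => [|i r IHr].
  by exists (\0) => x _; rewrite big_nil.
have [Pi|NPi] := boolP (P i).
  have [l fl] := linear_onD (lf i Pi) IHr.
  by exists l => x sx; rewrite big_cons Pi fl.
by have [l fl] := IHr; exists l => x sx; rewrite big_cons (negPf NPi) fl.
Qed.

Lemma linear_on_eq f g : (forall x, sigma x -> f x = g x) ->
  linear_on sigma g -> linear_on sigma f.
Proof. by move=> fg [l gl]; exists l => x sx; rewrite fg ?gl. Qed.

(** The sum of the generators serves as [x0]: a linear function that is
    nonnegative on every generator and zero on their sum kills each of them.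
    This replaces the topological statement that a nonnegative linear function
    with an interior zero is zero, and so also covers lower-dimensional
    cones. *)
Lemma cone_interior_point : rational_polyhedral_cone sigma ->
  exists2 x0, sigma x0 &
    forall f, linear_on sigma f -> (forall x, sigma x -> 0 <= f x) ->
      f x0 = 0 -> forall x, sigma x -> f x = 0.
Proof.
move=> [k [g def_s]].
have sg i : sigma (lattice_point (g i)).
  rewrite def_s /=; exists (fun j => (j == i)%:R); split=> [j|].
    by rewrite ler0n.
  rewrite (bigD1 i) //= eqxx scale1r big1 ?addr0 // => j /negPf ->.
  by rewrite scale0r.
have s0 : sigma (\sum_i lattice_point (g i)).
  rewrite def_s; exists (fun=> 1); split=> [i|]; first exact: ler01.
  by apply: eq_bigr => i _; rewrite scale1r.
exists (\sum_i lattice_point (g i)) => // f [l fl] f_ge0.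
rewrite fl // linear_sum => /eqP.
rewrite psumr_eq0 => [/allP l0|i _]; last by rewrite -fl // f_ge0.
move=> x sx; rewrite fl //; move: sx; rewrite def_s => -[c [_ ->]].
rewrite linear_sum big1 // => i _; rewrite linearZ /=.
by rewrite (eqP (l0 i (mem_index_enum i))) mulr0.
Qed.

End LinearOnCones.

(** * Split bundles *)

Section SplitBundles.
Context {R : realType} {n : nat} (Sigma : set (set 'rV[R]_n)).

(** A sum over [B] of functions each dominated by, and equal at [x0] to, a
    coordinate of [Bs] is itself linear, so there is no room for any of the
    dominations to be strict. *)
Lemma split_coordinate_linear (E : ttvb Sigma) (B : {set ground E}) sigma b :
  is_fan Sigma -> is_basis (bmatroid E) B ->
  (forall x, apartment (bmatroid E) B (Phi E x)) ->
  Sigma sigma -> b \in B -> linear_on sigma (fun x => Phi E x b).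
Proof.
move=> [_ cones _ _] bB wB Ss bInB.
have [Bs [bBs wBs linBs]] := ttvb_linear E Ss.
have [x0 sx0 vanish] := cone_interior_point (cones _ Ss).1.
(* For [c] off [Bs], [d] is an element of the fundamental circuit at which the
   minimum defining the coordinate [c] is attained at the point [x0]. *)
have dominate c : exists d, [/\ d \in Bs, Phi E x0 d = Phi E x0 c
                    & forall x, sigma x -> Phi E x c <= Phi E x d].
  have [cBs|cNBs] := boolP (c \in Bs); first by exists c.
  have [C cC CcB] := fundamental_circuit bBs cNBs.
  have minC x (sx : sigma x) := (wBs x sx).2 c C cNBs cC CcB.
  have [[d dC eq_d] _] := minC x0 sx0; exists d; split=> // [|x sx].
    move: dC; rewrite !inE => /andP[d_ne /(fintype.subsetP CcB)].
    by rewrite !inE (negPf d_ne).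
  by have [_] := minC x sx; apply.
have [j jP] := choice dominate.
pose gap x := \sum_(c in B) (Phi E x (j c) - Phi E x c).
have term_ge0 x c : sigma x -> 0 <= Phi E x (j c) - Phi E x c.
  by move=> sx; rewrite subr_ge0; have [_ _] := jP c; apply.
(* The subtracted sum over [B] is replaced by the one over [Bs], all of whose
   terms are known to be linear. *)
have gap_lin : linear_on sigma gap.
  apply: (@linear_on_eq _ _ _ _ (fun x =>
    \sum_(c in B) Phi E x (j c) - \sum_(c in Bs) Phi E x c)).
    move=> x sx; rewrite /gap sumrB.
    by rewrite (apartment_sum_eq bB bBs (wB x) (wBs x sx)).
  apply: linear_onB; apply: linear_on_sum => c cIn; last exact: linBs.
  by apply: linBs; have [] := jP c.
have gap0 : gap x0 = 0.
  by rewrite /gap big1 // => c _; have [_ -> _] := jP c; rewrite subrr.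
have gap_ge0 x : sigma x -> 0 <= gap x.
  by move=> sx; apply: sumr_ge0 => c _; apply: term_ge0.
have [jbBs _ _] := jP b; apply: linear_on_eq (linBs _ jbBs) => x sx.
have /eqP := vanish _ gap_lin gap_ge0 gap0 x sx.
rewrite psumr_eq0 => [/allP/(_ b (mem_index_enum b))|c _]; last exact: term_ge0.
by rewrite bInB subr_eq0 => /eqP.
Qed.

(** The summands are indexed by enumerating the basis [B] whose apartment
    contains the image of [Phi]. *)
Lemma split_direct_sum (E : ttvb Sigma) : is_fan Sigma -> is_split E ->
  exists (r : nat) (psi : 'I_r -> line_bundle Sigma),
    extension_step (direct_sum psi) E.
Proof.
move=> fanS [B bB wB].
have lin (i : 'I_#|B|) sigma (Ss : Sigma sigma) :
    linear_on sigma (fun x => Phi E x (enum_val i)).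
  by apply: split_coordinate_linear bB wB Ss _; rewrite ?enum_valP.
pose psi (i : 'I_#|B|) :=
  LineBundle (@ttvb_integral _ _ _ E (enum_val i)) (lin i).
have imB : enum_val @: [set: 'I_#|B|]%SET = B.
  apply/setP => e; apply/imsetP/idP => [[i _ ->]|eB]; first exact: enum_valP.
  by exists (enum_rank_in eB e); rewrite ?inE ?enum_rankK_in.
exists #|B|, psi, enum_val => [|x]; last first.
  by rewrite -[LHS](push_apartment bB (wB x) imB).
split=> [||A]; first exact: enum_val_inj.
  by rewrite (mrank_basis bB) mrank_indep // cardsT card_ord.
apply/esym/(indep_subset _ (basis_indep bB)).
by apply/fintype.subsetP => e /imsetP[i _ ->]; apply: enum_valP.
Qed.

Lemma free_split (E : ttvb Sigma) : is_free (bmatroid E) -> is_split E.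
Proof.
move=> freeE; exists [set: ground E]%SET => // x.
by split=> [|e C]; [exact: ttvb_Berg | rewrite inE].
Qed.

Lemma direct_sum_free r (psi : 'I_r -> line_bundle Sigma) :
  is_free (bmatroid (direct_sum psi)).
Proof. by apply/maxsetP; split=> // B _; rewrite finset.subTset => /eqP. Qed.

End SplitBundles.

Theorem proposition9p2 (R : realType) (n : nat) (Sigma : set (set 'rV[R]_n))
    (Sigma_fan : is_fan Sigma) (Sigma_complete : is_complete Sigma)
    (E : ttvb Sigma) :
  ((exists E' : ttvb Sigma, same_class E E' /\ is_free (bmatroid E')) <->
   (exists (r : nat) (psi : 'I_r -> line_bundle Sigma),
      same_class E (direct_sum psi))) /\
  ((exists (r : nat) (psi : 'I_r -> line_bundle Sigma),
      same_class E (direct_sum psi)) <->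
   (exists E' : ttvb Sigma, same_class E E' /\ is_split E')).
Proof.
have c_b E' : same_class E E' -> is_split E' ->
    exists (r : nat) (psi : 'I_r -> line_bundle Sigma),
      same_class E (direct_sum psi).
  move=> EE' /(split_direct_sum Sigma_fan)[r [psi step]]; exists r, psi.
  exact: rst_trans EE' (rst_sym _ _ _ _ (rst_step _ _ _ _ step)).
split; split.
- by case=> E' [EE' /free_split]; apply: c_b.
- by case=> r [psi Epsi]; exists (direct_sum psi); split=> //;
    apply: direct_sum_free.
- by case=> r [psi Epsi]; exists (direct_sum psi); split=> //;
    apply/free_split/direct_sum_free.
- by case=> E' [EE']; apply: c_b.
Qed.
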